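(* Assume that for every $x^*\in E^*$ the weak limit $\text{weak-}\lim_{t\to\infty}Q_tx^*$ exists in $E$. If $S$ is $Q$-symmetric, i.e. $S(t)Q=QS^*(t)$ for all $t\ge0$, then $S$ restricts to a selfadjoint and strongly stable $C_0$-semigroup of contractions on $H$.
   Context: $E$ is a real Banach space with dual $E^*$; $S=\{S(t)\}_{t\ge0}$ is a $C_0$-semigroup of bounded linear operators on $E$ with adjoint operators $S^*(t)$ on $E^*$. $H$ is a real Hilbert space with a continuous injective linear map $i:H\to E$; $H$ is identified with its image in $E$, and $Q:=i\circ i^*\in\mathcal L(E^*,E)$ ($H$ being identified with its dual). For $t>0$, $Q_t x^*:=\int_0^t S(s)QS^*(s)x^*\,ds$ for $x^*\in E^*$. ''$S$ restricts to a $C_0$-semigroup on $H$'' means that $S(t)H\subseteq H$ for all $t\ge0$ and the restrictions $S_H(t)=S(t)|_H$ form a $C_0$-semigroup on $H$. It is selfadjoint if each $S_H(t)$ is selfadjoint on $H$, and strongly stable if $\lim_{t\to\infty}\|S_H(t)h\|_H=0$ for all $h\in H$. *)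

(* Defs.v *)
From HB Require Import structures.
From mathcomp Require Import all_boot all_order all_algebra.
From mathcomp Require Import all_classical all_reals all_analysis.

Set Implicit Arguments.
Unset Strict Implicit.
Unset Printing Implicit Defensive.
Import Order.TTheory GRing.Theory Num.Theory.
Import numFieldNormedType.Exports.
Local Open Scope classical_set_scope.
Local Open Scope ring_scope.

Section bochner.
Context {d : measure_display} {T : measurableType d} {R : realType}.
Context {E : normedModType R}.
Variables (mu : {measure set T -> \bar R}) (D : set T).

Definition simple_on (g : T -> E) : Prop :=
  [/\ finite_set (range g),
      forall y, measurable (D `&` g @^-1` [set y]) &
      forall y, y != 0 -> (mu (D `&` g @^-1` [set y]) < +oo)%E].

(* For y = 0 the measure may be infinite; its junk value under [fine] is
   multiplied by the zero vector. *)
Definition simple_integral (g : T -> E) : E :=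
  \sum_(y \in range g) fine (mu (D `&` g @^-1` [set y])) *: y.

Definition strongly_measurable (f : T -> E) : Prop :=
  exists g : nat -> T -> E, (forall n, simple_on (g n)) /\
    {ae mu, forall x, D x -> g n x @[n --> \oo] --> f x}.

Definition is_bochner_integral (f : T -> E) (I : E) : Prop :=
  strongly_measurable f /\
  exists g : nat -> T -> E,
    [/\ forall n, simple_on (g n),
        (\int[mu]_(x in D) (`|f x - g n x|)%:E)%E @[n --> \oo] --> 0%E &
        simple_integral (g n) @[n --> \oo] --> I].

(* 0 if f is not Bochner integrable on D *)
Definition bochner_integral (f : T -> E) : E :=
  xget 0 [set I | is_bochner_integral f I].

End bochner.

(* The dual of a normed space V is represented by the functionals
   [xs : {linear V -> R^o}] satisfying [continuous xs]. *)

Definition weak_cvg {R : realType} {E : normedModType R} {T : Type}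
    (F : set_system T) (u : T -> E) (l : E) : Prop :=
  forall xs : {linear E -> R^o}, continuous xs -> xs (u t) @[t --> F] --> xs l.

Definition dual_op {R : realType} {V W : normedModType R}
    (A : {linear V -> W}) (xs : {linear W -> R^o}) : {linear V -> R^o} :=
  xs \o A.

(* Only the values S t with 0 <= t are relevant. *)
Definition C0_semigroup {R : realType} {V : normedModType R}
    (S : R -> {linear V -> V}) : Prop :=
  [/\ forall t, 0 <= t -> continuous (S t),
      forall x, S 0 x = x,
      forall s t, 0 <= s -> 0 <= t -> forall x, S (s + t) x = S s (S t x) &
      forall x, S t x @[t --> 0^'+] --> x].

Definition hilbert_norm {R : realType} {H : normedModType R}
    (dot : {dot H for idfun}) : Prop :=
  forall h, `|h| ^+ 2 = dot h h.

Section reproducing_operator.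
Context {R : realType} {E H : completeNormedModType R}.
Variables (dot : {dot H for idfun}) (i : {linear H -> E}).

(* The identification of the dual of H with H: the vector representing f, which
   exists and is unique for continuous f by the Riesz representation theorem
   when H is a Hilbert space. *)
Definition riesz (f : {linear H -> R^o}) : H :=
  xget 0 [set g | forall h, dot g h = f h].

Definition Qop (xs : {linear E -> R^o}) : E := i (riesz (dual_op i xs)).

Variable S : R -> {linear E -> E}.

Definition Qt (t : R) (xs : {linear E -> R^o}) : E :=
  bochner_integral lebesgue_measure `[0, t]
    (fun s : R => S s (Qop (dual_op (S s) xs))).

Definition Q_symmetric : Prop :=
  forall t, 0 <= t -> forall xs : {linear E -> R^o}, continuous xs ->
    S t (Qop xs) = Qop (dual_op (S t) xs).

(* In terms of the injection i this says that each S t with 0 <= t maps the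
   range of i into itself, with SH t the operator induced on H. *)
Definition restricts_to (SH : R -> {linear H -> H}) : Prop :=
  forall t, 0 <= t -> forall h, S t (i h) = i (SH t h).

End reproducing_operator.

Section hilbert_semigroup.
Context {R : realType} {H : normedModType R}.
Variable SH : R -> {linear H -> H}.

Definition selfadjoint_semigroup (dot : {dot H for idfun}) : Prop :=
  forall t, 0 <= t -> forall g h, dot (SH t g) h = dot g (SH t h).

Definition contraction_semigroup : Prop :=
  forall t, 0 <= t -> forall h, `|SH t h| <= `|h|.

Definition strongly_stable : Prop :=
  forall h, `|SH t h| @[t --> +oo] --> (0 : R).

End hilbert_semigroup.

(* Main.v *)
Require Import Defs.
From HB Require Import structures.
From mathcomp Require Import all_boot all_order all_algebra.
From mathcomp Require Import all_classical all_reals all_analysis.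
From mathcomp Require Import measurable_realfun ring lra.

(** Write [i^*] for the adjoint of [i], so that [Q = i i^*], and [D] for the range
    of [i^*]. Since [i] is injective and continuous functionals separate the
    points of [E] ([Hahn_Banach_separation]), [D] is dense in [H] ([adj_dense]).

    [Q]-symmetry reads [S(t) i (i^* x) = i (i^* S^*(t) x)], so [S(t)] acts on
    [D] by [T(t) i^* x = i^* S^*(t) x], and for [g = i^* x] one has
    [<T(s) g, T(t) g> = phi(s + t)] with [phi(s) = x(S(s) Q x)] ([inner_orbit]).
    The integrand of [x(Q_t x)] is [phi(2 s) = |T(s) g|^2]. From
    [2 phi(t) = 2 <T(s) g, T(t - s) g> <= |T(s) g|^2 + |T(t - s) g|^2], averaging
    over [s] between [0] and [t] gives [t phi(t) <= x(Q_t x)] ([le_Qt]). The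
    right-hand side stays bounded as [t] grows because [Q_t x] converges weakly; hence
    [|T(t) g|^2 = phi(2 t)] is [O(1/t)], which is strong stability on [D]
    ([orbit_stable]).

    Contractivity follows from stability: by Cauchy-Schwarz the sequence
    [|T(n t) g|] is log-convex, and a log-convex sequence tending to [0] cannot
    increase at its first step ([orbit_contraction]). The operators therefore
    extend from [D] to contractions of [H]; the extension is obtained by
    representing [d |-> <h, T(t) d>] on [D] by a vector ([S_preserves_H]), and
    agrees with [S(t)] on the image of [H]. Selfadjointness, strong continuity
    and stability pass from [D] to [H] by density.

    The estimate on [Q_t] involves a Bochner integral. Local boundedness of [S]
    makes [s |-> S(2 s) Q x] uniformly continuous on bounded intervals
    ([orbit_uniformly_continuous]), and the Bochner integral of such a function
    is the limit of its midpoint sums ([midpoint_sum_cvg]), which any continuous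
    functional commutes with and which are invariant under [s |-> t - s]. *)

Set Implicit Arguments.
Unset Strict Implicit.
Unset Printing Implicit Defensive.
Import Order.TTheory GRing.Theory Num.Theory.
Import numFieldNormedType.Exports.
Local Open Scope classical_set_scope.
Local Open Scope ring_scope.

(** * Separation of points by continuous functionals *)

Section separation.
Context {R : realType} {V : normedModType R}.

(** Partial functionals are encoded by their graphs, so that unions of chains
    are plain unions of sets; domination by the norm makes such a graph
    single-valued. *)
Definition dominated_linear_relation (G : set (V * R)) : Prop :=
  (forall c x y a b, G (x, a) -> G (y, b) -> G (c *: x + y, c * a + b)) /\
  (forall x a, G (x, a) -> a <= `|x|).

Lemma dominated_linear_relation_functional G x a b :
  dominated_linear_relation G -> G (x, a) -> G (x, b) -> a = b.
Proof.
move=> [lG dG].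
suff le u v : G (x, u) -> G (x, v) -> v <= u.
  by move=> Ga Gb; apply/le_anti/andP; split; exact: le.
move=> Gu Gv; have /dG := lG (-1) _ _ _ _ Gu Gv.
by rewrite scaleN1r addNr normr0 mulN1r addrC subr_le0.
Qed.

(** One-dimensional extension step: the value [c] at [x0] must satisfy
    [b - |y - x0| <= c <= |y + x0| - b'] for all pairs of the graph, and the
    supremum of the left-hand sides works by the triangle inequality. Domination
    at [y + s *: x0] then follows by rescaling by [|s|]. *)
Lemma dominated_linear_relation_extend G x0 : G !=set0 ->
  dominated_linear_relation G ->
  exists c, dominated_linear_relation
    [set p | exists y b s, [/\ G (y, b), p.1 = y + s *: x0 & p.2 = b + s * c]].
Proof.
move=> [[y0 b0] G0] [lG dG].
pose A := [set z : R | exists y b, G (y, b) /\ z = b - `|y - x0|].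
have Aub y b : G (y, b) -> ubound A (`|y + x0| - b).
  move=> Gyb _ [z [a [Gza ->]]].
  have /dG := lG 1 _ _ _ _ Gyb Gza.
  rewrite scale1r mul1r => h.
  have : `|y + z| <= `|y + x0| + `|z - x0|.
    by rewrite (le_trans _ (ler_normD _ _))// addrACA subrr addr0.
  by move: h; lra.
have A0 : A !=set0 by exists (b0 - `|y0 - x0|), y0, b0.
have hsA : has_sup A by split => //; exists (`|y0 + x0| - b0); exact: Aub.
pose c := sup A.
have scaleG s y b : G (y, b) -> s != 0 -> G (s^-1 *: y, s^-1 * b).
  move=> Gyb s0; have G00 : G (0, 0).
    by have := lG (-1) _ _ _ _ Gyb Gyb; rewrite scaleN1r mulN1r !addNr.
  by have := lG s^-1 _ _ _ _ Gyb G00; rewrite !addr0.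
have cpos y b : G (y, b) -> b + c <= `|y + x0|.
  by move=> Gyb; rewrite -lerBrDl; apply: ge_sup => //; exact: Aub.
have cneg y b : G (y, b) -> b - c <= `|y - x0|.
  move=> Gyb; rewrite lerBlDr -lerBlDl; apply: ub_le_sup; first exact: hsA.2.
  by exists y, b.
exists c; split.
  move=> k _ _ _ _ [y [b [s [/= Gyb -> ->]]]] [y' [b' [s' [/= Gyb' -> ->]]]].
  exists (k *: y + y'), (k * b + b'), (k * s + s'); split => /=.
  - exact: lG.
  - by rewrite scalerDr scalerDl scalerA addrACA.
  - by ring.
move=> _ _ [y [b [s [/= Gyb -> ->]]]].
have [s0|s0|->] := ltgtP s 0.
- have sn : s != 0 by rewrite lt_eqF.
  have sN0 : 0 < - s by rewrite oppr_gt0.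
  have sNn : - s != 0 by rewrite oppr_eq0.
  have := cneg _ _ (scaleG (- s) _ _ Gyb sNn).
  rewrite -(ler_pM2l sN0) mulrBr mulrA mulfV ?oppr_eq0// mul1r mulNr opprK.
  move=> /le_trans; apply.
  rewrite -{1}(gtr0_norm sN0) -normrZ scalerBr scalerA mulfV ?oppr_eq0//.
  by rewrite scale1r scaleNr opprK.
- have sn : s != 0 by rewrite gt_eqF.
  have := cpos _ _ (scaleG s _ _ Gyb sn).
  rewrite -(ler_pM2l s0) mulrDr mulrA mulfV// mul1r.
  move=> /le_trans; apply.
  by rewrite -{1}(gtr0_norm s0) -normrZ scalerDr scalerA mulfV// scale1r.
- by rewrite scale0r mul0r !addr0; exact: dG.
Qed.

(** Zorn's lemma for the inclusion of graphs; a maximal one is total by the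
    one-dimensional extension. *)
Lemma dominated_linear_relation_total v : exists G : set (V * R),
  [/\ dominated_linear_relation G, G (v, `|v|) & forall x, exists a, G (x, a)].
Proof.
pose Q (G : set (V * R)) := dominated_linear_relation G /\ G (v, `|v|).
(* The empty graph is included because the empty chain has an empty union. *)
pose P := [set G | G = set0 \/ Q G].
have [G [PG maxG]] : exists A, P A /\ forall B, A `<` B -> ~ P B.
  apply: Zorn_bigcup => F FP totF.
  have [[X [FX X0]]|noX] := pselect (exists X, F X /\ X !=set0); last first.
    left; rewrite -subset0 => p [X FX Xp]; apply: noX; exists X.
    by split => //; exists p.
  have QF Y : F Y -> Y !=set0 -> Q Y.
    by move=> /FP[->[]//|].
  have [_ Xv] := QF X FX X0.
  right; split; last by exists X.
  split.
    move=> c x y a b [Y FY Yxa] [Z FZ Zyb].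
    have [YZ|ZY] := totF _ _ FY FZ.
      exists Z => //; have [[lZ _] _] := QF Z FZ (ex_intro _ _ Zyb).
      by apply: lZ => //; exact: YZ.
    exists Y => //; have [[lY _] _] := QF Y FY (ex_intro _ _ Yxa).
    by apply: lY => //; exact: ZY.
  move=> x a [Y FY Yxa]; have [[_ dY] _] := QF Y FY (ex_intro _ _ Yxa).
  exact: dY.
(* The maximal graph is not empty: the functional on the line of v is larger. *)
have line : Q [set p | exists s : R, p = (s *: v, s * `|v|)].
  split; last by exists 1; rewrite scale1r mul1r.
  split.
    move=> c _ _ _ _ [s [-> ->]] [r [-> ->]]; exists (c * s + r).
    by rewrite scalerDl scalerA mulrDl mulrA.
  move=> _ _ [s [-> ->]]; rewrite normrZ ler_wpM2r//; exact: ler_norm.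
have {PG} [dG Gv] : Q G.
  case: PG => // G0; exfalso.
  apply: (maxG _ _ (or_intror line)); rewrite G0; split; first exact: sub0set.
  by move/(_ (v, `|v|)); apply; exists 1; rewrite scale1r mul1r.
exists G; split => // x.
have G0 : G !=set0 by exists (v, `|v|).
have [c dG'] := @dominated_linear_relation_extend G x G0 dG.
set G' := (X in dominated_linear_relation X) in dG'.
have GG' : G `<=` G'.
  by move=> [y b] Gyb; exists y, b, 0; rewrite scale0r mul0r !addr0.
have G'G : G' `<=` G.
  apply: contrapT => nG'G; apply: (maxG G'); first by [].
  by right; split => //; exact: GG'.
exists c; apply: G'G => /=; exists 0, 0, 1; rewrite !add0r scale1r mul1r; split => //.
by have := dG.1 (-1) _ _ _ _ Gv Gv; rewrite scaleN1r mulN1r !addNr.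
Qed.

(** A consequence of the Hahn-Banach theorem: continuous functionals separate
    points. It is what turns injectivity of an operator into density of the
    range of its adjoint. *)
Lemma Hahn_Banach_separation (v : V) : v != 0 ->
  exists xs : {linear V -> R^o}, continuous xs /\ xs v != 0.
Proof.
move=> v0; have [G [dG Gv tG]] := dominated_linear_relation_total v.
have [f Gf] := choice tG.
have lf : linear (f : V -> R^o).
  move=> c x y; apply: (dominated_linear_relation_functional dG (Gf _)).
  exact: dG.1.
pose F : {linear V -> R^o} := HB.pack (f : V -> R^o)
  (GRing.isLinear.Build _ _ _ _ (f : V -> R^o) lf).
exists F; split; last first.
  by rewrite /= (dominated_linear_relation_functional dG (Gf v) Gv) normr_eq0.
apply: bounded_linear_continuous; apply/ex_bound; exists 1.
apply/nbhs_norm0P; exists 1 => //= x /= x1.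
apply: le_trans (ltW x1); rewrite ler_norml; apply/andP; split.
  rewrite lerNl -[- f x]/(- F x) -linearN -normrN; exact: (dG.2 _ _ (Gf _)).
exact: (dG.2 _ _ (Gf _)).
Qed.

End separation.

(** * Cauchy sequences and bounded operators *)

Lemma cvg_of_cauchy_seq {R : realType} {V : completeNormedModType R}
    (u : nat -> V) :
  (forall e : R, 0 < e -> exists N, forall n, (N <= n)%N -> `|u N - u n| < e) ->
  exists l : V, u n @[n --> \oo] --> l.
Proof.
move=> cu; apply/cvg_ex/cauchy_cvgP/cauchy_exP => e e0.
have [N uN] := cu e e0; exists (u N).
by rewrite /fmapE -ball_normE; exists N => // n; exact: uN.
Qed.

Lemma continuous_linear_bound {R : realType} (V W : normedModType R)
    (A : {linear V -> W}) :
  continuous A -> exists2 M, 0 < M & forall x, `|A x| <= M * `|x|.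
Proof.
move=> cA; have /linear_boundedP/pinfty_ex_gt0[M M0 HM] :=
  continuous_linear_bounded 0 (cA 0).
by exists M.
Qed.

Lemma continuous_dual_op {R : realType} (V W : normedModType R)
    (A : {linear V -> W}) (xs : {linear W -> R^o}) : continuous A -> continuous xs ->
  continuous (dual_op A xs).
Proof.
move=> cA cx v; apply: (@continuous_comp _ _ _ A xs); [exact: cA|exact: cx].
Qed.

(** * Hilbert spaces *)

Section hilbert_space.
Context {R : realType} {H : completeNormedModType R}.
Variable dot : {dot H for idfun}.
Hypothesis hilbertH : hilbert_norm dot.

(** A name for the values of [dot] on the Hilbert space, with operands and
    result at the carrier types: rewriting with the generic lemmas on bilinear
    forms is sensitive to the structure through which [H] is seen. *)
Definition inner (g h : H) : R := dot g h.

Lemma innerC g h : inner g h = inner h g.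
Proof. by rewrite /inner hermC expr0 mul1r. Qed.

Lemma innerDr g h k : inner g (h + k) = inner g h + inner g k.
Proof. by rewrite /inner linearDr. Qed.

Lemma innerZr g a h : inner g (a *: h) = a * inner g h.
Proof. by rewrite /inner linearZr_LR. Qed.

Lemma innerDl g h k : inner (g + h) k = inner g k + inner h k.
Proof. by rewrite innerC innerDr !(innerC k). Qed.

Lemma innerZl a g h : inner (a *: g) h = a * inner g h.
Proof. by rewrite innerC innerZr innerC. Qed.

Lemma inner0l h : inner 0 h = 0.
Proof. by rewrite -(scale0r h) innerZl mul0r. Qed.

Lemma innerNr g h : inner g (- h) = - inner g h.
Proof. by rewrite -scaleN1r innerZr mulN1r. Qed.

Lemma innerBl g h k : inner (g - h) k = inner g k - inner h k.
Proof. by rewrite innerDl -scaleN1r innerZl mulN1r. Qed.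

Lemma inner_norm h : inner h h = `|h| ^+ 2.
Proof. by rewrite hilbertH. Qed.

Lemma inner_self_eq0 h : inner h h = 0 -> h = 0.
Proof. by rewrite inner_norm => /eqP; rewrite sqrf_eq0 normr_eq0 => /eqP. Qed.

Lemma inner_inj g g' : (forall h, inner g h = inner g' h) -> g = g'.
Proof.
move=> gg'; apply/eqP; rewrite -subr_eq0; apply/eqP/inner_self_eq0.
by rewrite innerBl gg' subrr.
Qed.

Lemma normrD_sqr (g h : H) :
  `|g + h| ^+ 2 = `|g| ^+ 2 + 2 * inner g h + `|h| ^+ 2.
Proof.
by rewrite -!inner_norm innerDl !innerDr (innerC h g); ring.
Qed.

Lemma Cauchy_Schwarz g h : `|inner g h| <= `|g| * `|h|.
Proof.
have [->|g0] := eqVneq g 0.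
  by rewrite inner0l normr0 mulr_ge0.
have gn0 : 0 < `|g| ^+ 2 by rewrite exprn_gt0// normr_gt0.
have : 0 <= `|h + (- (inner g h / `|g| ^+ 2)) *: g| ^+ 2 by rewrite sqr_ge0.
rewrite normrD_sqr innerZr normrZ exprMn real_normK ?num_real// (innerC h g).
have -> : `|h| ^+ 2 + 2 * (- (inner g h / `|g| ^+ 2) * inner g h)
    + (- (inner g h / `|g| ^+ 2)) ^+ 2 * `|g| ^+ 2
    = `|h| ^+ 2 - inner g h ^+ 2 / `|g| ^+ 2.
  by field; rewrite normr_eq0.
rewrite subr_ge0 ler_pdivrMr// => key.
rewrite -ler_sqr ?nnegrE ?mulr_ge0// real_normK ?num_real//.
by rewrite exprMn mulrC.
Qed.

Lemma parallelogram (g h : H) :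
  `|g - h| ^+ 2 + `|g + h| ^+ 2 = 2 * `|g| ^+ 2 + 2 * `|h| ^+ 2.
Proof. by rewrite !normrD_sqr innerNr normrN; ring. Qed.

Lemma inner_continuous g : continuous (inner g).
Proof.
have lg : linear (inner g : H -> R^o).
  by move=> c x y; rewrite innerDr innerZr.
pose L : {linear H -> R^o} := HB.pack (inner g : H -> R^o)
  (GRing.isLinear.Build _ _ _ _ (inner g : H -> R^o) lg).
apply: (@bounded_linear_continuous _ _ R^o L).
apply/ex_bound; exists `|g|; apply/nbhs_norm0P; exists 1 => //= x /= x1.
by rewrite (le_trans (Cauchy_Schwarz _ _))// ler_piMr// ltW.
Qed.

(** Riesz representation for a functional that is only known to be linear and
    bounded on a subspace [P], not assumed closed: minimise
    [|h|^2 - 2 * f h] over [P]. By the parallelogram law a minimising sequence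
    is Cauchy; its limit [p] lies in the closure of [P], and the first-order
    condition at the minimum is [inner p x = f x]. With [P] the whole space this
    is the usual representation theorem, and with [f := inner h] it is the
    orthogonal projection of [h] on the closure of [P]. *)
Lemma riesz_on_subspace (P : set H) (f : H -> R) (C : R) :
  P 0 ->
  (forall c x y, P x -> P y -> P (c *: x + y)) ->
  (forall c x y, P x -> P y -> f (c *: x + y) = c * f x + f y) ->
  0 <= C -> (forall x, P x -> `|f x| <= C * `|x|) ->
  exists p, [/\ forall x, P x -> inner p x = f x, `|p| <= C &
    forall e, 0 < e -> exists2 x, P x & `|p - x| < e].
Proof.
move=> P0 PL fL C0 fC.
pose J (h : H) : R := `|h| ^+ 2 - 2 * f h.
have JC h : P h -> - C ^+ 2 <= J h.
  move=> /fC fh; have := le_trans (ler_norm _) fh.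
  have := sqr_ge0 (`|h| - C); rewrite /J; nra.
pose A : set R := J @` P.
have A0 : A !=set0 by exists (J 0), 0.
have hiA : has_inf A.
  by split => //; exists (- C ^+ 2) => _ [h Ph <-]; exact: JC.
pose m := inf A.
have mJ h : P h -> m <= J h by move=> Ph; apply: ge_inf; [exact: hiA.2|exists h].
have near_m (n : nat) : exists h, P h /\ J h < m + n.+1%:R^-1.
  have n0 : 0 < n.+1%:R^-1 :> R by rewrite invr_gt0.
  by have [_ [h Ph <-] hJ] := inf_adherent n0 hiA; exists h.
have [d dP] := choice near_m.
have Pd n := (dP n).1.
have f0 : f 0 = 0.
  by have := fL 1 0 0 P0 P0; rewrite scaler0 addr0; lra.
have JD h x s : P h -> P x ->
    J (s *: x + h) = J h + 2 * s * (inner h x - f x) + s ^+ 2 * `|x| ^+ 2.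
  move=> Ph Px; rewrite /J normrD_sqr fL// innerZl normrZ exprMn.
  by rewrite real_normK ?num_real// (innerC h x); ring.
(* Parallelogram law at the midpoint of a and b, where J is at least m. *)
have Jdist a b : P a -> P b -> `|a - b| ^+ 2 <= 2 * (J a - m) + 2 * (J b - m).
  move=> Pa Pb; have Pab : P (a + b) by have := PL 1 _ _ Pa Pb; rewrite scale1r.
  have Ph : P (2^-1 *: (a + b)).
    by have := PL 2^-1 _ _ Pab P0; rewrite addr0.
  have := mJ _ Ph; rewrite {1}/J normrZ exprMn real_normK ?num_real//.
  have -> : f (2^-1 *: (a + b)) = 2^-1 * (f a + f b).
    have := fL 2^-1 _ _ Pab P0; rewrite addr0 f0 addr0 => ->; congr (_ * _).
    by have := fL 1 _ _ Pa Pb; rewrite scale1r mul1r.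
  have := parallelogram a b; rewrite /J.
  have -> : (2^-1 : R) ^+ 2 = 4^-1 by field.
  have lin (u v p q fa fb M : R) : u + v = 2 * p + 2 * q ->
    M <= 4^-1 * v - 2 * (2^-1 * (fa + fb)) ->
    u <= 2 * (p - 2 * fa - M) + 2 * (q - 2 * fb - M) by lra.
  exact: lin.
have dN N n : (N <= n)%N -> `|d N - d n| ^+ 2 <= 4 * N.+1%:R^-1.
  move=> Nn; apply: le_trans (Jdist _ _ (Pd N) (Pd n)) _.
  have lin (a b p q M : R) : b <= a -> p < M + a -> q < M + b ->
    2 * (p - M) + 2 * (q - M) <= 4 * a by lra.
  have le_inv : n.+1%:R^-1 <= N.+1%:R^-1 :> R by rewrite lef_pV2 ?posrE// ler_nat.
  exact: (lin _ _ _ _ _ le_inv (dP N).2 (dP n).2).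
have [p dp] : exists p : H, d n @[n --> \oo] --> p.
  apply: cvg_of_cauchy_seq => e e0.
  have e4 : 0 < e ^+ 2 / 4 by rewrite divr_gt0// exprn_gt0.
  have [N _ Ne] := near_infty_natSinv_lt (PosNum e4).
  exists N => n Nn; rewrite -(@ltr_pXn2r _ 2)// ?nnegrE ?(ltW e0)//.
  apply: le_lt_trans (dN _ _ Nn) _.
  by have := Ne N (leqnn N); rewrite /= ltr_pdivlMr// mulrC.
have pf x : P x -> inner p x = f x.
  move=> Px; have quad s : 0 <= 2 * s * (inner p x - f x) + s ^+ 2 * `|x| ^+ 2.
    have lhs : (n.+1%:R^-1 + (2 * s * (inner (d n) x - f x) + s ^+ 2 * `|x| ^+ 2))
        @[n --> \oo] --> (0 + (2 * s * (inner p x - f x) + s ^+ 2 * `|x| ^+ 2) : R).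
      apply: cvgD; first exact: cvg_harmonic.
      apply: cvgD; last exact: cvg_cst.
      apply: cvgMl_tmp; apply: cvgB; last exact: cvg_cst.
      under eq_fun do rewrite innerC.
      rewrite innerC; apply: continuous_cvg dp; exact: inner_continuous.
    rewrite -[leRHS]add0r; apply: cvgr_to_ge lhs _.
    apply: nearW => n.
    have := mJ _ (PL s _ _ Px (Pd n)); rewrite JD//.
    have lin (a u v w M : R) : u < M + a -> M <= u + v + w -> 0 <= a + (v + w).
      by lra.
    exact: lin (dP n).2.
  apply/eqP; rewrite -subr_eq0; apply/eqP; set D := inner p x - f x.
  have n1 : 0 < `|x| ^+ 2 + 1 by rewrite ltr_wpDl// sqr_ge0.
  (* Close to the minimiser of the quadratic; adding 1 avoids dividing by 0. *)
have := quad (- D / (`|x| ^+ 2 + 1)); rewrite -/D.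
  have -> : 2 * (- D / (`|x| ^+ 2 + 1)) * D + (- D / (`|x| ^+ 2 + 1)) ^+ 2 * `|x| ^+ 2
    = - (D ^+ 2 * (`|x| ^+ 2 + 2) / (`|x| ^+ 2 + 1) ^+ 2).
    by field; rewrite gt_eqF.
  rewrite oppr_ge0 pmulr_lle0 ?invr_gt0 ?exprn_gt0// pmulr_lle0; last first.
    by rewrite ltr_wpDl// sqr_ge0.
  by move=> D2; apply/eqP; rewrite -sqrf_eq0; apply/eqP/le_anti; rewrite D2 sqr_ge0.
exists p; split => //; last first.
  move=> e e0; have /cvgrPdist_lt/(_ e e0)[N _ HN] := dp.
  by exists (d N) => //; exact: HN N (leqnn N).
have [->|p0] := eqVneq p 0; first by rewrite normr0.
have pn0 : 0 < `|p| by rewrite normr_gt0.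
have lim_ge0 : C * `|d n| - inner p (d n) @[n --> \oo] --> C * `|p| - inner p p.
  apply: cvgB; first by apply: cvgMl_tmp; exact: cvg_norm.
  by apply: continuous_cvg dp; exact: inner_continuous.
have : 0 <= C * `|p| - inner p p.
  apply: cvgr_to_ge lim_ge0 _; apply: nearW => n.
  by rewrite pf// subr_ge0 (le_trans (ler_norm _))// fC.
by rewrite subr_ge0 inner_norm expr2 ler_pM2r.
Qed.

Lemma Riesz_representation (f : H -> R) (C : R) : 0 <= C ->
  (forall c x y, f (c *: x + y) = c * f x + f y) ->
  (forall x, `|f x| <= C * `|x|) -> exists p, forall x, inner p x = f x.
Proof.
move=> C0 fl fC.
have [p [pf _ _]] := @riesz_on_subspace setT f C I
  (fun _ _ _ _ _ => I) (fun c x y _ _ => fl c x y) C0 (fun x _ => fC x).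
by exists p => x; exact: pf.
Qed.

End hilbert_space.

(** * Integrals of simple functions and uniqueness of the Bochner integral *)

Section finite_partition.
Context {d : measure_display} {T : measurableType d} {R : realType}.
Variables (mu : {measure set T -> \bar R}) (D : set T).
Hypothesis mD : measurable D.

(** A finite labelling of the points of [D] by measurable cells. On a set of
    finite measure, simple functions are the functions that factor through such
    a labelling, and two of them factor through a common one, so that their
    difference can be computed cell by cell. *)
Definition measurable_index (I : finType) (k : T -> I) : Prop :=
  forall j, measurable (D `&` k @^-1` [set j]).

Lemma bigcup_cells (I : finType) (k : T -> I) (P : set I) :
  D `&` k @^-1` P = \bigcup_(j in P) (D `&` k @^-1` [set j]).
Proof.
apply/seteqP; split=> [x [Dx Px]|x [j Pj [Dx /= kx]]]; first by exists (k x).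
by split=> //=; rewrite kx.
Qed.

Lemma trivIset_cells (I : finType) (k : T -> I) (P : set I) :
  trivIset P (fun j => D `&` k @^-1` [set j]).
Proof.
apply/trivIsetP => i j _ _ ij; rewrite -subset0 => x [[_ /= ki] [_ /= kj]].
by rewrite -ki -kj eqxx in ij.
Qed.

Lemma measurable_index_pair (I J : finType) (k : T -> I) (l : T -> J) :
  measurable_index k -> measurable_index l ->
  measurable_index (fun x => (k x, l x)).
Proof.
move=> mk ml [i j].
have -> : D `&` (fun x => (k x, l x)) @^-1` [set (i, j)] =
    (D `&` k @^-1` [set i]) `&` (D `&` l @^-1` [set j]).
  apply/seteqP; split=> [x [Dx /= [<- <-]]//|x [[Dx /= <-] [_ /= <-]]//].
exact: measurableI.
Qed.

Lemma measurable_fun_index (I : finType) (k : T -> I) (phi : I -> T -> R) :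
  measurable_index k -> (forall j, measurable_fun D (phi j)) ->
  measurable_fun D (fun x => phi (k x) x).
Proof.
move=> mk mphi _ B mB.
have -> : D `&` (fun x => phi (k x) x) @^-1` B =
    \bigcup_j ((D `&` k @^-1` [set j]) `&` (D `&` phi j @^-1` B)).
  apply/seteqP; split=> [x [Dx Bx]|x [j _ [[Dx /= <-] [_ Bx]]]//].
  by exists (k x).
apply: fin_bigcup_measurable; first exact: finite_finset.
by move=> j _; apply: measurableI; [exact: mk|exact: mphi].
Qed.

Hypothesis muD : (mu D < +oo)%E.

Lemma fin_num_cell (I : finType) (k : T -> I) (P : set I) :
  measurable_index k -> mu (D `&` k @^-1` P) \is a fin_num.
Proof.
move=> mk; rewrite ge0_fin_numE//; apply: le_lt_trans muD.
apply: le_measure; rewrite ?inE//.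
rewrite bigcup_cells; apply: fin_bigcup_measurable => //; exact: finite_finset.
Qed.

Lemma ge0_integral_index (I : finType) (k : T -> I) (F : I -> R) :
  measurable_index k -> (forall j, 0 <= F j) ->
  (\int[mu]_(x in D) (F (k x))%:E =
   (\sum_j fine (mu (D `&` k @^-1` [set j])) * F j)%:E)%E.
Proof.
move=> mk F0.
have DE : \big[setU/set0]_(j <- index_enum I) (D `&` k @^-1` [set j]) = D.
  rewrite -bigcup_seq; apply/seteqP; split=> [x [j _ []]//|x Dx].
  by exists (k x) => //=; rewrite mem_index_enum.
rewrite -[X in (\int[mu]_(x in X) _)%E]DE ge0_integral_bigsetU.
- rewrite -sumEFin; apply: eq_bigr => j _.
  rewrite (eq_integral (cst (F j)%:E)); last by move=> x /[!inE] -[_ /= ->].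
  rewrite integral_cst// muleC EFinM fineK//; exact: fin_num_cell.
- exact: mk.
- exact: index_enum_uniq.
- exact: trivIset_cells.
- rewrite DE; apply/measurable_EFinP.
  by apply: (@measurable_fun_index _ k (fun j _ => F j)) => // j; exact: measurable_cst.
- by move=> x _; rewrite lee_fin.
Qed.

Section vector_valued.
Context {E : normedModType R}.

Lemma simple_on_index (I : finType) (k : T -> I) (h : I -> E) :
  measurable_index k -> simple_on mu D (h \o k).
Proof.
move=> mk.
have pre y : D `&` (h \o k) @^-1` [set y] = D `&` k @^-1` (h @^-1` [set y]) by [].
split.
- apply: (@sub_finite_set _ _ (range h)); last first.
    by apply: finite_image; exact: finite_finset.
  by move=> _ [x _ <-]; exists (k x).
- move=> y; rewrite pre bigcup_cells.
  by apply: fin_bigcup_measurable => //; exact: finite_finset.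
- by move=> y _; rewrite pre -ge0_fin_numE//; exact: fin_num_cell.
Qed.

Lemma simple_on_factor (g : T -> E) : simple_on mu D g ->
  exists (I : finType) (k : T -> I) (h : I -> E),
    measurable_index k /\ g = h \o k.
Proof.
move=> [/finite_seqP[s gs] mg _].
have gin x : exists j : seq_sub s, ssval j = g x.
  have : [set` s] (g x) by rewrite -gs; exists x.
  by move=> /= gx; exists (SeqSub gx).
have [k kg] := choice gin.
exists (seq_sub s), k, (@ssval _ s); split; last by apply/funext => x /=; rewrite kg.
move=> j; have -> : k @^-1` [set j] = g @^-1` [set ssval j]; last exact: mg.
by apply/seteqP; split=> [x /= <-|x /= gx]; [rewrite kg|apply: val_inj; rewrite /= kg].
Qed.

(** The sum over the values of [h \o k] is regrouped as a sum over the labels: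
    the level set of a value is the disjoint union of the cells with that
    value. *)
Lemma simple_integral_index (I : finType) (k : T -> I) (h : I -> E) :
  measurable_index k ->
  simple_integral mu D (h \o k) =
    \sum_j fine (mu (D `&` k @^-1` [set j])) *: h j.
Proof.
move=> mk; rewrite /simple_integral.
pose s := undup [seq h j | j <- index_enum I].
have sE : [set` s] = range h.
  apply/seteqP; split=> [y /=|_ [j _ <-] /=].
    by rewrite mem_undup => /mapP[j _ ->]; exists j.
  by rewrite mem_undup map_f// mem_index_enum.
rewrite (fsbig_widen _ (range h)).
- rewrite -sE -fsbig_seq ?undup_uniq//=.
  transitivity (\sum_(y <- s) \sum_(j | h j == y)
      fine (mu (D `&` k @^-1` [set j])) *: h j).
    apply: eq_bigr => y _.
    rewrite (_ : D `&` _ = D `&` k @^-1` (h @^-1` [set y]))//.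
    rewrite bigcup_cells measure_fin_bigcup//; last 2 first.
    + exact: finite_finset.
    + exact: trivIset_cells.
    pose r := [seq j <- index_enum I | h j == y].
    have <- : [set` r] = h @^-1` [set y].
      apply/seteqP; split=> [j /=|j /= hj].
        by rewrite mem_filter => /andP[/eqP].
      by rewrite mem_filter hj eqxx mem_index_enum.
    rewrite -fsbig_seq ?filter_uniq ?index_enum_uniq//=.
    rewrite -sum_fine; last by move=> j _; exact: fin_num_cell.
    rewrite scaler_suml big_filter; apply: eq_bigr => j /eqP ->//.
  rewrite (exchange_big_dep xpredT)//=; apply: eq_bigr => j _.
  rewrite big_mkcond.
  rewrite (bigD1_seq (h j)) ?undup_uniq ?mem_undup ?map_f ?mem_index_enum//=.
  by rewrite eqxx big1 ?addr0// => y /negPf; rewrite eq_sym => ->.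
- by move=> _ [x _ <-]; exists (k x).
- move=> y [_ ny] /=.
  suff -> : D `&` (h \o k) @^-1` [set y] = set0 by rewrite measure0 scale0r.
  by rewrite -subset0 => x [_ /= hx]; apply: ny; exists x.
Qed.

(** The triangle inequality for integrals of simple functions, read on a common
    refinement of their cells. *)
Lemma simple_integral_dist (g g' : T -> E) :
  simple_on mu D g -> simple_on mu D g' ->
  ((`|simple_integral mu D g - simple_integral mu D g'|)%:E <=
   \int[mu]_(x in D) (`|g x - g' x|)%:E)%E.
Proof.
move=> /simple_on_factor[I [k [h [mk ->]]]] /simple_on_factor[J [l [h' [ml ->]]]].
pose kl x := (k x, l x).
have mkl : measurable_index kl by exact: measurable_index_pair.
rewrite -[h \o k]/((h \o fst) \o kl) -[h' \o l]/((h' \o snd) \o kl).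
rewrite !simple_integral_index//.
rewrite (ge0_integral_index (F := fun j => `|h j.1 - h' j.2|) mkl)//.
rewrite lee_fin -sumrB; apply: (le_trans (ler_norm_sum _ _ _)).
apply: ler_sum => j _; rewrite -scalerBr normrZ ger0_norm//.
Qed.

(** Two approximating sequences are both close to [f] in mean, hence close to
    each other, and so are their integrals. Measurability of [|f x - y|] is what
    makes the integrals of the two distances additive. *)
Lemma bochner_integral_unique (f : T -> E) (I J : E) :
  (forall y, measurable_fun D (fun x => `|f x - y|)) ->
  is_bochner_integral mu D f I -> is_bochner_integral mu D f J -> I = J.
Proof.
move=> mf [_ [g [sg gf gI]]] [_ [g' [sg' gf' gJ]]].
have mfg u : simple_on mu D u -> measurable_fun D (fun x => (`|f x - u x|)%:E).
  move=> /simple_on_factor[A [k [h [mk ->]]]]; apply/measurable_EFinP.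
  exact: (@measurable_fun_index _ k (fun j x => `|f x - h j|)).
have mgg (u v : T -> E) : simple_on mu D u -> simple_on mu D v ->
    measurable_fun D (fun x => (`|u x - v x|)%:E).
  move=> su sv; have [A [k [h [mk ->]]]] := simple_on_factor su.
  have [B [l [h' [ml ->]]]] := simple_on_factor sv.
  apply/measurable_EFinP.
  apply: (@measurable_fun_index _ (fun x => (k x, l x)) (fun j x => `|h j.1 - h' j.2|)).
    exact: measurable_index_pair.
  by move=> j; exact: measurable_cst.
have bound n : ((`|simple_integral mu D (g n) - simple_integral mu D (g' n)|)%:E <=
    \int[mu]_(x in D) (`|f x - g n x|)%:E + \int[mu]_(x in D) (`|f x - g' n x|)%:E)%E.
  apply: le_trans (simple_integral_dist (sg n) (sg' n)) _.
  rewrite -ge0_integralD//; try exact: mfg.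
  apply: ge0_le_integral => //.
  - exact: mgg.
  - by apply: emeasurable_funD; exact: mfg.
  - move=> x _; rewrite lee_fin -(distrC (g n x)).
    by apply: le_trans (ler_normD _ _); rewrite addrA subrK.
have cv : ((`|simple_integral mu D (g n) - simple_integral mu D (g' n)|)%:E
    @[n --> \oo] --> (`|I - J|)%:E)%E.
  by apply: cvg_EFin; [exact: nearW|apply: cvg_norm; exact: cvgB].
have : ((`|I - J|)%:E <= 0 + 0)%E.
  apply: (lee_cvg_to cv); last exact: nearW bound.
  exact: cvgeD.
by rewrite adde0 lee_fin normr_le0 subr_eq0 => /eqP.
Qed.

End vector_valued.
End finite_partition.

(** * Bochner integrals as limits of midpoint sums *)

Section midpoint_rule.
Context {R : realType} {E : completeNormedModType R}.
Local Notation mu := (@lebesgue_measure R).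

Definition uniformly_continuous_upto (t : R) (f : R -> E) : Prop :=
  forall e, 0 < e -> exists2 c, 0 < c &
    forall x y, x \in `[0, t] -> y \in `[0, t] -> `|x - y| < c ->
    `|f x - f y| < e.

(** Midpoints are chosen because they are exchanged by the reflection
    [s |-> t - s], a symmetry that is used to bound such sums from below. *)
Definition midpoint_sum (f : R -> E) (t : R) (n : nat) : E :=
  \sum_(j < n.+1) (t / n.+1%:R) *: f ((j%:R + 2^-1) * (t / n.+1%:R)).

Variable t : R.
Hypothesis t_gt0 : 0 < t.
Local Notation D := (`[0, t]%classic : set R).
Local Notation w n := (t / n.+1%:R).

Lemma mesh_gt0 n : 0 < w n.
Proof. by rewrite divr_gt0. Qed.

Lemma mesh_mul n : n.+1%:R * w n = t.
Proof. by rewrite mulrC divfK. Qed.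

Lemma mesh_small (c : R) : 0 < c -> exists N, forall n, (N <= n)%N -> w n < c.
Proof.
move=> c0; have ct : 0 < c / t by rewrite divr_gt0.
have [N _ HN] := near_infty_natSinv_lt (PosNum ct).
exists N => n /HN /=; rewrite ltr_pdivlMr// mulrC; exact.
Qed.

(** The minimum puts the right endpoint in the last cell. *)
Definition cell_index (n : nat) (x : R) : 'I_n.+1 :=
  inord (minn (Num.truncn (x / w n)) n).

Lemma cell_itv n (j : 'I_n.+1) :
  D `&` cell_index n @^-1` [set j] =
  if j == n :> nat then `[j%:R * w n, t]%classic
  else `[j%:R * w n, j.+1%:R * w n[%classic.
Proof.
have w0 := mesh_gt0 n.
have val_index x : val (cell_index n x) = minn (Num.truncn (x / w n)) n.
  by rewrite /cell_index /= inordK// ltnS geq_minr.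
have le0 x : 0 <= x -> 0 <= x / w n by move=> x0; rewrite divr_ge0// ltW.
case: ifPn => jn; apply/seteqP; split=> x /=; rewrite !in_itv/=.
- move=> [/andP[x0 xt] /(congr1 val)]; rewrite val_index => jE.
  have /minn_idPr := etrans jE (eqP jn); rewrite (eqP jn).
  by rewrite Num.Theory.truncn_ge_nat ?le0// ler_pdivlMr// => ->.
- move=> /andP[jx xt].
  have x0 : 0 <= x by apply: le_trans jx; rewrite mulr_ge0// ltW.
  split; first by rewrite x0.
  apply: val_inj; rewrite val_index -[RHS]/(nat_of_ord j) (eqP jn).
  rewrite (eqP jn) in jx.
  by apply/minn_idPr; rewrite Num.Theory.truncn_ge_nat ?le0// ler_pdivlMr.
- move=> [/andP[x0 xt] /(congr1 val)]; rewrite val_index => jE.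
  have tn : Num.truncn (x / w n) = j.
    by move: jE jn; rewrite /minn; case: ifP => // _ <-; rewrite eqxx.
  have := Num.Theory.truncn_eq j (le0 _ x0); rewrite tn eqxx => /esym.
  by rewrite ler_pdivlMr// ltr_pdivrMr.
- move=> /andP[jx xj].
  have x0 : 0 <= x by apply: le_trans jx; rewrite mulr_ge0// ltW.
  have jlt : (j < n)%N by rewrite ltn_neqAle jn -ltnS ltn_ord.
  split.
    rewrite x0/=; apply: (le_trans (ltW xj)); rewrite -[leRHS](mesh_mul n).
    by rewrite ler_pM2r// ler_nat ltnS ltnW.
  apply: val_inj; rewrite val_index.
  have /eqP -> : Num.truncn (x / w n) == j.
    by rewrite Num.Theory.truncn_eq ?le0// ler_pdivlMr// ltr_pdivrMr// jx.
  by apply/minn_idPl; exact: ltnW.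
Qed.

Lemma measurable_cell_index n : measurable_index D (cell_index n).
Proof. by move=> j; rewrite cell_itv; case: ifP. Qed.

Lemma measure_cell n (j : 'I_n.+1) :
  mu (D `&` cell_index n @^-1` [set j]) = (w n)%:E.
Proof.
have w0 := mesh_gt0 n.
rewrite cell_itv; case: ifPn => jn; rewrite lebesgue_measure_itv/= lte_fin.
  have tE : t = j%:R * w n + w n.
    by rewrite -{1}(mesh_mul n) (eqP jn) -natr1 mulrDl mul1r.
  by rewrite {2}tE ltrDl w0 -EFinB {1}tE addrC addKr.
by rewrite ltr_pM2r// ltr_nat ltnSn -EFinB -mulrBl -natrB// subSnn mul1r.
Qed.

Lemma cell_midpoint n x : D x ->
  `|x - ((cell_index n x)%:R + 2^-1) * w n| <= w n.
Proof.
move=> Dx; have w0 := mesh_gt0 n.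
have : (D `&` cell_index n @^-1` [set cell_index n x]) x by [].
have jn1 := ltn_ord (cell_index n x).
rewrite cell_itv; set j := cell_index n x in jn1 *.
have bnd : j%:R * w n <= x -> x <= j%:R * w n + w n ->
    `|x - (j%:R + 2^-1) * w n| <= w n.
  have lin (a u v : R) : 0 < v -> a <= u -> u <= a + v -> `|u - (a + 2^-1 * v)| <= v.
    by move=> *; rewrite ler_norml; apply/andP; split; lra.
  by rewrite mulrDl; exact: lin.
case: ifPn => jn /=; rewrite in_itv/= => /andP[a b]; apply: bnd => //.
  apply: (le_trans b); rewrite -[leLHS](mesh_mul n).
  by rewrite (eqP jn) -natr1 mulrDl mul1r.
by apply: (le_trans (ltW b)); rewrite -natr1 mulrDl mul1r.
Qed.

Variable f : R -> E.
Hypothesis f_unif : uniformly_continuous_upto t f.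

Definition midpoint_step (n : nat) : R -> E :=
  (fun j : 'I_n.+1 => f ((j%:R + 2^-1) * w n)) \o cell_index n.

Lemma midpoint_in n (j : 'I_n.+1) : (j%:R + 2^-1) * w n \in `[0, t].
Proof.
have w0 := mesh_gt0 n; rewrite in_itv/=; apply/andP; split.
  by rewrite mulr_ge0 ?(ltW w0)// addr_ge0.
rewrite -[leRHS](mesh_mul n) ler_pM2r//.
apply: (@le_trans _ _ (j%:R + 1)); first by rewrite lerD2l invf_le1// ler1n.
by rewrite natr1 ler_nat.
Qed.

Lemma midpoint_step_unif e : 0 < e ->
  exists N, forall n, (N <= n)%N -> forall x, D x -> `|f x - midpoint_step n x| < e.
Proof.
move=> /f_unif[c c0 fc]; have [N HN] := mesh_small c0.
exists N => n /HN wc x Dx; apply: fc => //; first exact: midpoint_in.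
exact: le_lt_trans (cell_midpoint n Dx) wc.
Qed.

Lemma midpoint_step_cvg x : D x -> midpoint_step n x @[n --> \oo] --> f x.
Proof.
move=> Dx; apply/cvgrPdist_lt => e e0.
by have [N HN] := midpoint_step_unif e0; exists N => // n Nn; exact: HN.
Qed.

Lemma measurable_itv0t : measurable D. Proof. exact: measurable_itv. Qed.

Lemma finite_itv0t : (mu D < +oo)%E.
Proof. by rewrite lebesgue_measure_itv/= lte_fin t_gt0 -EFinB ltry. Qed.

(** A pointwise limit of step functions is measurable. *)
Lemma measurable_norm_sub y : measurable_fun D (fun x => `|f x - y|).
Proof.
apply: (measurable_fun_cvg (h := fun n x => `|midpoint_step n x - y|)).
- move=> n; apply: (measurable_fun_index measurable_itv0t (k := cell_index n)
    (phi := fun j _ => `|f ((j%:R + 2^-1) * w n) - y|)).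
    exact: measurable_cell_index.
  by move=> j; exact: measurable_cst.
- move=> x Dx; apply: cvg_norm; apply: cvgB; last exact: cvg_cst.
  exact: midpoint_step_cvg.
Qed.

Lemma simple_on_midpoint_step n : simple_on mu D (midpoint_step n).
Proof.
apply: simple_on_index; [exact: measurable_itv0t|exact: finite_itv0t|].
exact: measurable_cell_index.
Qed.

Lemma simple_integral_midpoint_step n :
  simple_integral mu D (midpoint_step n) = midpoint_sum f t n.
Proof.
rewrite simple_integral_index; [|exact: measurable_itv0t|exact: finite_itv0t|
  exact: measurable_cell_index].
apply: eq_bigr => j _; congr (_ *: _).
exact: (congr1 fine (measure_cell j)).
Qed.

Lemma integral_bounded (g : R -> R) e : measurable_fun D g ->
  (forall x, D x -> 0 <= g x <= e) ->
  (\int[mu]_(x in D) (g x)%:E <= (e * t)%:E)%E.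
Proof.
move=> mg ge.
apply: (@le_trans _ _ (\int[mu]_(x in D) (cst e%:E x))%E).
  apply: ge0_le_integral => //.
  - by move=> x /ge /andP[]; rewrite lee_fin.
  - exact/measurable_EFinP.
  - by move=> x /ge /andP[]; rewrite lee_fin.
by rewrite integral_cst//= lebesgue_measure_itv/= lte_fin t_gt0 -EFinB subr0.
Qed.

(** The step functions converge uniformly to [f], and the interval has finite
    measure. *)
Lemma midpoint_sum_cauchy e : 0 < e ->
  exists N, forall n, (N <= n)%N ->
    `|midpoint_sum f t N - midpoint_sum f t n| < e.
Proof.
move=> e0; pose e' := e / (4 * t).
have e'0 : 0 < e' by rewrite divr_gt0// mulr_gt0.
have [N HN] := midpoint_step_unif e'0.
exists N => n Nn; rewrite -!simple_integral_midpoint_step.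
suff : `|simple_integral mu D (midpoint_step N) -
    simple_integral mu D (midpoint_step n)| <= (2 * e') * t.
  move=> /le_lt_trans; apply; rewrite /e'.
  have -> : 2 * (e / (4 * t)) * t = e / 2 by field; rewrite gt_eqF.
  by rewrite ltr_pdivrMr// ltr_pMr// ltr1n.
rewrite -lee_fin; apply: le_trans (simple_integral_dist _ _ _ _) _.
- exact: measurable_itv0t.
- exact: finite_itv0t.
- exact: simple_on_midpoint_step.
- exact: simple_on_midpoint_step.
apply: integral_bounded.
  apply: (measurable_fun_index measurable_itv0t
    (k := fun x => (cell_index N x, cell_index n x))
    (phi := fun j _ => `|f ((j.1%:R + 2^-1) * w N) - f ((j.2%:R + 2^-1) * w n)|)).
    by apply: measurable_index_pair; exact: measurable_cell_index.
  by move=> j; exact: measurable_cst.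
move=> x Dx; rewrite normr_ge0/=.
have h1 := ltW (HN _ (leqnn N) x Dx); have h2 := ltW (HN _ Nn x Dx).
apply: (le_trans (ler_distD (f x) _ _)).
by rewrite (distrC _ (f x)) mulr2n mulrDl mul1r lerD.
Qed.

(** A uniformly continuous function is Bochner integrable, since its midpoint
    step functions converge to it in mean; by uniqueness of the integral, the
    value selected in the definition of the integral is the limit of the
    midpoint sums. *)
Lemma midpoint_sum_cvg :
  midpoint_sum f t n @[n --> \oo] --> bochner_integral mu D f.
Proof.
have [I HI] := cvg_of_cauchy_seq midpoint_sum_cauchy.
have bI : is_bochner_integral mu D f I.
  split.
    exists midpoint_step; split; first exact: simple_on_midpoint_step.
    by apply: aeW => x Dx; exact: midpoint_step_cvg.
  exists midpoint_step; split.
  - exact: simple_on_midpoint_step.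
  - have small e : 0 < e -> exists N, forall n, (N <= n)%N ->
        (\int[mu]_(x in D) (`|f x - midpoint_step n x|)%:E <= e%:E)%E.
      move=> e0; have et0 : 0 < e / t by rewrite divr_gt0.
      have [N HN] := midpoint_step_unif et0; exists N => n Nn.
      have -> : e = e / t * t by rewrite divfK// gt_eqF.
      apply: integral_bounded; last by move=> x Dx; rewrite normr_ge0 ltW//= HN.
      apply: (measurable_fun_index measurable_itv0t (k := cell_index n)
        (phi := fun j x => `|f x - f ((j%:R + 2^-1) * w n)|)).
        exact: measurable_cell_index.
      by move=> j; exact: measurable_norm_sub.
    have ge0 n : (0 <= \int[mu]_(x in D) (`|f x - midpoint_step n x|)%:E)%E.
      by apply: integral_ge0 => x _; rewrite lee_fin.
    apply/fine_cvgP; split.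
      have [N HN] := small 1 ltr01; exists N => // n /HN le1.
      by rewrite ge0_fin_numE//; apply: le_lt_trans le1 _; rewrite ltry.
    apply/cvgrPdist_le => e e0; have [N HN] := small e e0.
    exists N => // n /HN le_e; rewrite sub0r normrN ger0_norm ?fine_ge0//.
    by rewrite -lee_fin fineK// ge0_fin_numE//; apply: le_lt_trans le_e _; rewrite ltry.
  - by under eq_fun do rewrite simple_integral_midpoint_step.
have bB : is_bochner_integral mu D f (bochner_integral mu D f).
  exact: (xgetPex 0 (ex_intro _ I bI)).
have -> // : bochner_integral mu D f = I.
  apply: (bochner_integral_unique _ _ _ bB bI).
  - exact: measurable_itv0t.
  - exact: finite_itv0t.
  - exact: measurable_norm_sub.
Qed.

End midpoint_rule.

(** * Local boundedness of strongly continuous semigroups *)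

Section C0_semigroup_bounds.
Context {R : realType} {E : completeNormedModType R}.
Variable S : R -> {linear E -> E}.
Hypothesis S_C0 : C0_semigroup S.

Lemma C0_near0 (x : E) (e : R) : 0 < e ->
  exists2 c, 0 < c & forall s : R, 0 <= s -> s < c -> `|S s x - x| < e.
Proof.
move=> e0; have [_ S0 _ /(_ x)/cvgrPdist_lt/(_ e e0)] := S_C0.
move=> [c /= c0 Hc]; exists c => // s s0 sc.
have [<-|sn0] := eqVneq 0 s; first by rewrite S0 subrr normr0.
rewrite distrC; apply: Hc => /=; last by rewrite lt_neqAle sn0.
by rewrite sub0r normrN ger0_norm.
Qed.

(** Otherwise there are times [s n] tending to [0] along which the operator
    norms are unbounded; but [S (s n) x] converges to [x] for every [x], in
    contradiction with the uniform boundedness principle. *)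
Lemma C0_bounded_near0 : exists (c M : R), 0 < c /\
  forall (s : R) x, 0 <= s -> s <= c -> `|S s x| <= M * `|x|.
Proof.
apply: contrapT => unbounded.
have bad n : exists p : R * E, [/\ 0 <= p.1, p.1 <= n.+1%:R^-1 &
    n%:R * `|p.2| < `|S p.1 p.2|].
  apply: contrapT => good; apply: unbounded; exists n.+1%:R^-1, n%:R.
  split=> [|s x s0 sn]; first by rewrite invr_gt0.
  by rewrite leNgt; apply/negP => lt; apply: good; exists (s, x).
have [p Hp] := choice bad.
pose F : set (E -> E) := [set f : E -> E | exists n, f = (S (p n).1 : E -> E)].
have linF f : F f -> bounded_fun_norm f /\ linear f.
  move=> [n ->]; have [p0 _ _] := Hp n.
  split; last by move=> c x y; exact: linearP.
  have [cS _ _ _] := S_C0.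
  have [M M0 HM] := continuous_linear_bound (cS _ p0).
  move=> r; exists (M * r) => x xr; apply: (le_trans (HM x)).
  by rewrite ler_pM2l.
have ptF : pointwise_bounded F.
  move=> x; have cv : S (p n).1 x @[n --> \oo] --> x.
    apply/cvgrPdist_lt => e e0; have [c c0 Hc] := C0_near0 x e0.
    have [N _ HN] := near_infty_natSinv_lt (PosNum c0).
    exists N => // n Nn; have [p0 pn _] := Hp n.
    by rewrite distrC; apply: Hc => //; apply: le_lt_trans pn (HN n Nn).
  have [M [_ HM]] := cvg_seq_bounded (cvgP _ cv).
  exists (M + 1) => _ [n ->]; by apply: (HM (M + 1)) => //; rewrite ltrDl.
have [M HM] := Banach_Steinhauss linF ptF 1.
have := Hp (Num.truncn M).+1; set n := (Num.truncn M).+1 => -[p0 _].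
set x := (p n).2; set s := (p n).1.
have [->|x0] := eqVneq x 0; first by rewrite linear0 normr0 mulr0 ltxx.
have xn0 : 0 < `|x| by rewrite normr_gt0.
have := HM _ (ex_intro _ n erefl) (`|x|^-1 *: x).
rewrite normrZ normfV normr_id mulVf ?gt_eqF// => /(_ (lexx _)).
rewrite linearZ normrZ normfV normr_id ler_pdivrMl// => h1 h2.
have := lt_le_trans h2 h1; rewrite mulrC ltr_pM2l//.
by rewrite ltNge ltW// truncnS_gt.
Qed.

(** A time at most [k * c] is a sum of [k] times at most [c], so the bound near
    [0] is raised to the power [k]. *)
Lemma C0_bounded_upto (t : R) : exists2 M, 0 < M &
  forall (s : R) x, 0 <= s -> s <= t -> `|S s x| <= M * `|x|.
Proof.
have [c [M0 [c0 HM0]]] := C0_bounded_near0.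
pose M := Num.max 1 M0.
have M1 : 1 <= M by rewrite le_max lexx.
have HM s x : 0 <= s -> s <= c -> `|S s x| <= M * `|x|.
  move=> s0 sc; apply: (le_trans (HM0 s x s0 sc)).
  by rewrite ler_wpM2r// le_max lexx orbT.
have [_ S0 SD _] := S_C0.
have Mk k s x : 0 <= s -> s <= k%:R * c -> `|S s x| <= M ^+ k * `|x|.
  elim: k s x => [|k IH] s x s0.
    rewrite mul0r => s0'; have -> : s = 0 by apply/le_anti; rewrite s0 s0'.
    by rewrite S0 expr0 mul1r.
  move=> sk; have [sc|cs] := leP s c.
    apply: (le_trans (HM _ _ s0 sc)); rewrite ler_wpM2r// exprS ler_peMr//.
      exact: le_trans ler01 M1.
    exact: exprn_ege1.
  have sc0 : 0 <= s - c by rewrite subr_ge0 ltW.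
  have -> : s = c + (s - c) by rewrite addrC subrK.
  rewrite SD ?(ltW c0)//; apply: (le_trans (HM _ _ (ltW c0) (lexx _))).
  rewrite exprS -mulrA ler_pM2l ?(lt_le_trans ltr01 M1)//; apply: IH => //.
  by rewrite lerBlDr; move: sk; rewrite -natr1 mulrDl mul1r.
pose k := (Num.truncn (t / c)).+1.
exists (M ^+ k); first by rewrite exprn_gt0// (lt_le_trans ltr01 M1).
move=> s x s0 st; apply: Mk => //; apply: (le_trans st).
by rewrite -ler_pdivrMr// ltW// truncnS_gt.
Qed.

(** For [r <= s], [S (r + r) y - S (s + s) y] is the image under [S (r + r)] of
    [y - S (2 * (s - r)) y], which is small by strong continuity at [0]; the
    operators are bounded uniformly up to time [2 * t]. The doubled time is the
    one that occurs in the integrand of [Qt] for a [Q]-symmetric semigroup. *)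
Lemma orbit_uniformly_continuous (t : R) (y : E) :
  uniformly_continuous_upto t (fun s => S (s + s) y).
Proof.
move=> e e0; have [M M0 HM] := C0_bounded_upto (t + t).
have eM : 0 < e / M by rewrite divr_gt0.
have [c c0 Hc] := C0_near0 y eM.
have [_ _ SD _] := S_C0.
have key r s : 0 <= r -> r <= s -> s <= t -> s - r < c / 2 ->
    `|S (r + r) y - S (s + s) y| < e.
  move=> r0 rs st d.
  have -> : s + s = (r + r) + ((s - r) + (s - r)) by ring.
  have sr0 : 0 <= s - r by rewrite subr_ge0.
  have rr0 : 0 <= r + r by rewrite addr_ge0.
  have d0 : 0 <= s - r + (s - r) by rewrite addr_ge0.
  have -> : S (r + r) y - S (r + r + (s - r + (s - r))) y =
      S (r + r) (y - S (s - r + (s - r)) y).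
    by rewrite (SD (r + r))// linearB.
  have b : `|S (r + r) (y - S (s - r + (s - r)) y)| <=
      M * `|y - S (s - r + (s - r)) y|.
    by apply: HM; rewrite // lerD// (le_trans rs st).
  apply: (le_lt_trans b); rewrite mulrC -ltr_pdivlMr// distrC.
  apply: Hc => //.
  by lra.
exists (c / 2); first by rewrite divr_gt0.
move=> r s; rewrite !in_itv/= => /andP[r0 rt] /andP[s0 st] d.
have [rs|sr] := leP r s.
  by apply: key => //; move: d; rewrite distrC ger0_norm// subr_ge0.
rewrite distrC; apply: key => //; first exact: ltW.
by move: d; rewrite ger0_norm// subr_ge0 ltW.
Qed.

End C0_semigroup_bounds.

(** * Restriction of a Q-symmetric semigroup to its Hilbert space *)

(** If [a 1 > a 0], then log-convexity makes the ratios of consecutive terms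
    nondecreasing, so the sequence increases and cannot be arbitrarily small at
    positive indices. *)
Lemma log_convex_cvg0_le {R : realType} (a : nat -> R) :
  (forall n, 0 <= a n) -> (forall n, a n.+1 ^+ 2 <= a n * a n.+2) ->
  (forall e, 0 < e -> exists n, a n < e /\ (0 < n)%N) -> a 1%N <= a 0%N.
Proof.
move=> a0 conv small; rewrite leNgt; apply/negP => a01.
have a1 : 0 < a 1%N by apply: le_lt_trans a01.
have inc n : a n <= a n.+1 /\ a 1%N <= a n.+1.
  elim: n => [|n [nS n1]]; first by split => //; exact: ltW.
  have an1 : 0 < a n.+1 by exact: lt_le_trans n1.
  suff le : a n.+1 <= a n.+2 by split => //; exact: le_trans le.
  rewrite -(ler_pM2l an1) -expr2; apply: (le_trans (conv n)).
  by rewrite ler_wpM2r.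
have [[|n] [an // _]] := small _ a1.
by have [_] := inc n; rewrite leNgt an.
Qed.

Section Q_symmetric_semigroup.
Context {R : realType} {E H : completeNormedModType R}.
Variables (dot : {dot H for idfun}) (i : {linear H -> E}).
Variable S : R -> {linear E -> E}.
Hypothesis hilbertH : hilbert_norm dot.
Hypothesis i_cont : continuous i.
Hypothesis i_inj : injective i.
Hypothesis S_C0 : C0_semigroup S.
Hypothesis Q_sym : Q_symmetric dot i S.

(* adj is the adjoint of i, with H identified with its dual, and orbit t xs is
   the image under adj of the adjoint of S t applied to xs. *)
Local Notation inner := (inner dot).
Local Notation adj xs := (riesz dot (dual_op i xs)).
Local Notation orbit t xs := (adj (dual_op (S t) xs)).

Lemma adjP (xs : {linear E -> R^o}) h : continuous xs ->
  inner (adj xs) h = xs (i h).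
Proof.
move=> cx; have [M M0 HM] := continuous_linear_bound (continuous_dual_op i_cont cx).
have [p Hp] : exists p, forall x, inner p x = xs (i x).
  apply: (@Riesz_representation _ _ dot hilbertH _ M (ltW M0)) => // c x y.
  by rewrite !linearP.
exact: (xgetPex 0 (ex_intro (fun g => forall h, dot g h = dual_op i xs h) p Hp)).
Qed.

(** The range of the adjoint of [i] has trivial orthogonal complement, because
    [i] is injective and functionals separate the points of [E]. *)
Lemma adj_total (g h : H) :
  (forall xs : {linear E -> R^o}, continuous xs ->
     inner (adj xs) g = inner (adj xs) h) -> g = h.
Proof.
move=> gh; apply: i_inj; apply/eqP; rewrite -subr_eq0; apply/negPn/negP => n0.
have [xs [cx]] := Hahn_Banach_separation n0.
by rewrite linearB /= -!adjP// gh// subrr eqxx.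
Qed.

Lemma adjD c (xs ys : {linear E -> R^o}) : continuous xs -> continuous ys ->
  exists2 zs : {linear E -> R^o}, continuous zs & c *: adj xs + adj ys = adj zs.
Proof.
move=> cx cy.
have lz : linear ((fun e => c * xs e + ys e) : E -> R^o).
  move=> a u v; rewrite (linearP xs) (linearP ys).
  have lin (p q r s : R) : c * (a * p + q) + (a * r + s)
    = a * (c * p + r) + (c * q + s) by ring.
  exact: lin.
pose zs : {linear E -> R^o} := HB.pack ((fun e => c * xs e + ys e) : E -> R^o)
  (GRing.isLinear.Build _ _ _ _ ((fun e => c * xs e + ys e) : E -> R^o) lz).
have cz : continuous zs.
  by move=> e; apply: cvgD; [apply: cvgMl_tmp; exact: cx|exact: cy].
exists zs => //; apply: (inner_inj hilbertH) => h.
by rewrite innerDl innerZl !adjP.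
Qed.

Definition adj_range : set H :=
  [set g | exists2 xs : {linear E -> R^o}, continuous xs & g = adj xs].

Lemma adj_range_linear c g h :
  adj_range g -> adj_range h -> adj_range (c *: g + h).
Proof.
move=> [xs cx ->] [ys cy ->].
by have [zs cz ->] := adjD c cx cy; exists zs.
Qed.

Lemma adj_range0 : adj_range 0.
Proof.
have c0 : continuous (\0 : {linear E -> R^o}) by move=> x; exact: cvg_cst.
exists \0 => //; apply: (inner_inj hilbertH) => g.
by rewrite adjP// inner0l.
Qed.

(** The projection [p] of [h] on the closure of the range has the same inner
    products as [h] with the elements of the range, hence equals [h]. *)
Lemma adj_dense h e : 0 < e ->
  exists2 xs : {linear E -> R^o}, continuous xs & `|h - adj xs| < e.
Proof.
move=> e0.
have [] := @riesz_on_subspace _ _ dot hilbertH adj_range (inner h) `|h|.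
- exact: adj_range0.
- exact: adj_range_linear.
- by move=> c x y _ _; rewrite innerDr innerZr.
- exact: normr_ge0.
- by move=> x _; exact: Cauchy_Schwarz.
move=> p [ph _ /(_ e e0)[_ [xs cx ->] pe]]; exists xs => //.
suff <- : p = h by [].
apply: adj_total => ys cy; rewrite innerC ph; last by exists ys.
by rewrite innerC.
Qed.

Lemma continuous_orbit t (xs : {linear E -> R^o}) : 0 <= t -> continuous xs ->
  continuous (dual_op (S t) xs).
Proof. by move=> t0; apply: continuous_dual_op; have [cS _ _ _] := S_C0; exact: cS. Qed.

(** Reading [Q] as [i] after its adjoint, [Q]-symmetry says that [S t] maps
    [i (adj xs)] into the range of [i], with preimage [orbit t xs]: this is the
    restricted semigroup on the dense subspace [adj_range]. *)
Lemma orbitE t (xs : {linear E -> R^o}) : 0 <= t -> continuous xs ->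
  i (orbit t xs) = S t (i (adj xs)).
Proof. by move=> t0 cx; rewrite -[LHS]/(Qop dot i _) -Q_sym. Qed.

(** The inner product depends on [s + t] only: this is symmetry of the
    restricted semigroup, and every estimate below comes from it. *)
Lemma inner_orbit s t (xs : {linear E -> R^o}) : 0 <= s -> 0 <= t ->
  continuous xs ->
  inner (orbit s xs) (orbit t xs) = xs (S (s + t) (i (adj xs))).
Proof.
move=> s0 t0 cx; rewrite adjP; last exact: continuous_orbit.
by rewrite orbitE//=; have [_ _ SD _] := S_C0; rewrite SD.
Qed.

Lemma orbit0 (xs : {linear E -> R^o}) : continuous xs -> orbit 0 xs = adj xs.
Proof.
by move=> cx; apply: i_inj; rewrite orbitE//; have [_ S0 _ _] := S_C0; rewrite S0.
Qed.

(** With [phi s := xs (S s (i (adj xs)))], the integrand of [xs (Qt t xs)] is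
    [phi (2 * s) = |orbit s xs|^2]. Since
    [phi (2 * a) + phi (2 * b) - 2 * phi (a + b)] is the square of the norm of
    [orbit a xs - orbit b xs], pairing [s] with [t - s] shows that the mean value
    of the integrand over [0, t] is at least [phi t]. *)
Lemma le_Qt (xs : {linear E -> R^o}) t : continuous xs -> 0 < t ->
  t * xs (S t (i (adj xs))) <= xs (Qt dot i S t xs).
Proof.
move=> cx t0; pose y := i (adj xs).
pose f s := S s (Qop dot i (dual_op (S s) xs)).
have fE s : 0 <= s -> f s = S (s + s) y.
  by move=> s0; rewrite /f -Q_sym//; have [_ _ SD _] := S_C0; rewrite SD.
have fu : uniformly_continuous_upto t f.
  move=> e e0; have [c c0 Hc] := orbit_uniformly_continuous S_C0 t y e0.
  exists c => // r s rt st rs; rewrite !fE; first exact: Hc.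
    by move: st; rewrite in_itv => /andP[].
  by move: rt; rewrite in_itv => /andP[].
have cv : xs (midpoint_sum f t n) @[n --> \oo] --> xs (Qt dot i S t xs).
  by apply: continuous_cvg (midpoint_sum_cvg t0 fu); exact: cx.
apply: cvgr_to_ge cv _; apply: nearW => n.
set w := t / n.+1%:R; have w0 : 0 < w by rewrite divr_gt0.
pose F (j : 'I_n.+1) := xs (f ((j%:R + 2^-1) * w)).
have -> : xs (midpoint_sum f t n) = w * \sum_j F j.
  by rewrite linear_sum mulr_sumr; apply: eq_bigr => j _; rewrite linearZ.
have pair j : 2 * xs (S t y) <= F j + F (rev_ord j).
  set a := (j%:R + 2^-1) * w; set b := ((rev_ord j)%:R + 2^-1) * w.
  have a0 : 0 <= a by rewrite mulr_ge0 ?(ltW w0)// addr_ge0.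
  have b0 : 0 <= b by rewrite mulr_ge0 ?(ltW w0)// addr_ge0.
  have ab : a + b = t.
    rewrite /a /b -mulrDl /= subSS natrB ?leq_ord//.
    have -> : j%:R + 2^-1 + (n%:R - j%:R + 2^-1) = n.+1%:R :> R.
      by rewrite -natr1; field.
    by rewrite /w mulrC divfK.
  have := sqr_ge0 `|orbit a xs - orbit b xs|.
  rewrite (normrD_sqr hilbertH) innerNr normrN -!(inner_norm hilbertH).
  rewrite !inner_orbit// ab /F !fE//.
  by rewrite -/y; lra.
have sumF : 2 * \sum_j F j = \sum_j (F j + F (rev_ord j)).
  rewrite big_split /= [X in _ = _ + X](reindex_inj rev_ord_inj)/=.
  under [X in _ = _ + X]eq_bigr do rewrite rev_ordK.
  by rewrite mulr2n mulrDl mul1r.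
have : \sum_(j < n.+1) 2 * xs (S t y) <= \sum_j (F j + F (rev_ord j)).
  by apply: ler_sum => j _; exact: pair.
rewrite -sumF sumr_const card_ord -[X in X <= _]mulr_natl => h.
have : n.+1%:R * xs (S t y) <= \sum_j F j by move: h; rewrite mulrCA ler_pM2l.
rewrite -(ler_pM2l w0); congr (_ <= _).
by rewrite mulrA /w divfK.
Qed.

Hypothesis Q_lim : forall xs : {linear E -> R^o}, continuous xs ->
  exists q : E, weak_cvg +oo (fun t : R => Qt dot i S t xs) q.

(** Weak convergence bounds [xs (Qt t xs)] by a constant [C] for large [t], so
    [|orbit t xs|^2 = phi (2 * t)] is at most [C / (2 * t)]. *)
Lemma orbit_stable (xs : {linear E -> R^o}) e : continuous xs -> 0 < e ->
  exists2 t0, 0 < t0 & forall t, t0 <= t -> `|orbit t xs| < e.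
Proof.
move=> cx e0; have [q /(_ xs cx)] := Q_lim cx.
move=> /cvgrPdist_lt/(_ 1 ltr01)[A [_ HA]].
pose C := `|xs q| + 1.
have C0 : 0 < C by rewrite ltr_wpDl.
have e20 : 0 < e ^+ 2 by rewrite exprn_gt0.
(* Beyond A the bound C is valid, and C / (2 t) < e ^+ 2 once t >= C / e ^+ 2. *)
pose t0 := Num.max 1 (Num.max (A + 1) (C / e ^+ 2)).
have t01 : 0 < t0 by rewrite lt_max ltr01.
exists t0 => // t; rewrite !ge_max => /and3P[t1 tA tC].
have t_gt0 : 0 < t by exact: lt_le_trans t1.
have tt0 : 0 < t + t by rewrite addr_gt0.
have Qb : xs (Qt dot i S (t + t) xs) < C.
  have : `|xs q - xs (Qt dot i S (t + t) xs)| < 1.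
    by apply: HA; move: tA t_gt0; lra.
  rewrite distrC => h; have := le_lt_trans (ler_norm _) h.
  have lin (u v n : R) : u - v < 1 -> v <= n -> u < n + 1 by lra.
  by move=> /lin; apply; exact: ler_norm.
have := le_lt_trans (le_Qt cx tt0) Qb.
rewrite -inner_orbit ?(ltW t_gt0)// inner_norm// => h.
rewrite -(@ltr_pXn2r _ 2)// ?nnegrE ?(ltW e0)//.
rewrite -(ltr_pM2l tt0); apply: (lt_le_trans h).
move: tC; rewrite ler_pdivrMr// => /le_trans; apply.
by rewrite ler_pM2r// lerDl ltW.
Qed.

(** By [inner_orbit] and Cauchy-Schwarz, [n |-> |orbit (n * t) xs|] is
    log-convex, and it tends to [0]. *)
Lemma orbit_contraction (xs : {linear E -> R^o}) t : continuous xs -> 0 <= t ->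
  `|orbit t xs| <= `|adj xs|.
Proof.
move=> cx; rewrite le_eqVlt => /predU1P[<-|t0]; first by rewrite orbit0.
have nt n : 0 <= n%:R * t by rewrite mulr_ge0// ltW.
have := @log_convex_cvg0_le _ (fun n => `|orbit (n%:R * t) xs|).
rewrite mul1r mul0r orbit0//; apply.
- by move=> n; exact: normr_ge0.
- move=> n; rewrite -(inner_norm hilbertH) inner_orbit//.
  have -> : n.+1%:R * t + n.+1%:R * t = n%:R * t + n.+2%:R * t.
    by rewrite -!mulrDl -!natrD addSnnS.
  rewrite -inner_orbit//.
  exact: le_trans (ler_norm _) (Cauchy_Schwarz hilbertH _ _).
- move=> e e0; have [t1 t10 Ht1] := orbit_stable cx e0.
  exists (Num.truncn (t1 / t)).+1; split => //; apply: Ht1.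
  by rewrite -ler_pdivrMr// ltW// truncnS_gt.
Qed.

(** The bounded functional [d |-> inner h (Tt d)] on [adj_range], where [Tt] is
    the restriction of [S t] to that subspace, is represented by a vector [p].
    For [d = adj xs] this reads [xs (i p) = xs (S t (i h))], so [i p = S t (i h)]
    as functionals separate points, and the norm bound is part of the
    representation. *)
Lemma S_preserves_H t h : 0 <= t ->
  exists p, S t (i h) = i p /\ `|p| <= `|h|.
Proof.
move=> t0.
pose Tt d := xget 0 [set g | i g = S t (i d)].
have TtE (xs : {linear E -> R^o}) : continuous xs -> Tt (adj xs) = orbit t xs.
  move=> cx; apply: i_inj; rewrite orbitE//.
  exact: (xgetPex 0 (ex_intro (fun g => i g = S t (i (adj xs))) _ (orbitE t0 cx))).
have [] := @riesz_on_subspace _ _ dot hilbertH adj_range (fun d => inner h (Tt d)) `|h|.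
- exact: adj_range0.
- exact: adj_range_linear.
- move=> c _ _ [xs cx ->] [ys cy ->]; rewrite -innerZr -innerDr; congr (inner _ _).
  have [zs cz zE] := adjD c cx cy; rewrite zE !TtE//; apply: i_inj.
  by rewrite linearP /= !orbitE// -zE !linearP.
- exact: normr_ge0.
- move=> _ [xs cx ->]; rewrite TtE//.
  apply: (le_trans (Cauchy_Schwarz hilbertH _ _)).
  by rewrite ler_wpM2l// orbit_contraction.
move=> p [ph ple _]; exists p; split => //.
apply/esym/eqP; rewrite -subr_eq0; apply/negPn/negP => n0.
have [xs [cx]] := Hahn_Banach_separation n0.
rewrite linearB /= -adjP// innerC ph; last by exists xs.
by rewrite TtE// innerC adjP ?subrr ?eqxx//; exact: continuous_orbit.
Qed.

Lemma restriction_exists : exists SH : R -> {linear H -> H},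
  restricts_to i S SH /\ contraction_semigroup SH.
Proof.
have ex t : exists L : {linear H -> H}, 0 <= t ->
    (forall h, S t (i h) = i (L h)) /\ (forall h, `|L h| <= `|h|).
  (* Negative times are unconstrained; any linear map will do. *)
  have [t0|t0] := leP 0 t; last by exists idfun.
  have [L HL] := choice (fun h => S_preserves_H h t0).
  have lL : linear L.
    by move=> c g h; apply: i_inj; rewrite -(HL _).1 !linearP !(HL _).1 -linearP.
  pose L' : {linear H -> H} := HB.pack L (GRing.isLinear.Build _ _ _ _ L lL).
  exists L' => _.
  by split=> h; [exact: (HL h).1|exact: (HL h).2].
have [SH HSH] := choice ex; exists SH.
by split=> t t0 h; [exact: (HSH t t0).1|exact: (HSH t t0).2].
Qed.

Section restriction.
Variable SH : R -> {linear H -> H}.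
Hypothesis SH_restr : restricts_to i S SH.
Hypothesis SH_contr : contraction_semigroup SH.

Lemma restriction_adj t (xs : {linear E -> R^o}) : 0 <= t -> continuous xs ->
  SH t (adj xs) = orbit t xs.
Proof. by move=> t0 cx; apply: i_inj; rewrite orbitE// SH_restr. Qed.

(** Let [p] represent [g |-> inner (SH t g) h]. By symmetry on [adj_range], [p]
    and [SH t h] have the same inner products with all [adj xs], so they
    coincide. *)
Lemma restriction_selfadjoint : selfadjoint_semigroup SH dot.
Proof.
move=> t t0 g h; rewrite -[LHS]/(inner _ _) -[RHS]/(inner _ _).
have [p Hp] : exists p, forall g', inner p g' = inner (SH t g') h.
  apply: (@Riesz_representation _ _ dot hilbertH _ `|h|) => //.
  - by move=> c x y; rewrite linearP innerDl innerZl.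
  - move=> x; apply: (le_trans (Cauchy_Schwarz hilbertH _ _)).
    by rewrite mulrC ler_wpM2l// SH_contr.
rewrite -Hp innerC; congr (inner _ _).
apply: adj_total => xs cx; rewrite innerC Hp restriction_adj//.
by rewrite !adjP//= -?SH_restr//; exact: continuous_orbit.
Qed.

(** Stability holds on the dense subspace [adj_range] and passes to its closure
    because the operators are contractions. *)
Lemma restriction_strongly_stable : strongly_stable SH.
Proof.
move=> h; apply/cvgrPdist_lt => e e0.
have e2 : 0 < e / 2 by rewrite divr_gt0.
have [xs cx hx] := adj_dense h e2.
have [t0 t00 Ht0] := orbit_stable cx e2.
exists t0; split; first exact: num_real.
move=> t /= /ltW t0t; have t_ge0 : 0 <= t by apply: le_trans t0t; exact: ltW.
rewrite sub0r normrN normr_id -(subrK (adj xs) h) linearD restriction_adj//.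
apply: (le_lt_trans (ler_normD _ _)); rewrite (splitr e); apply: ltrD.
  by apply: le_lt_trans hx; exact: SH_contr.
exact: Ht0.
Qed.

(** Strong continuity at [0] is shown on [adj_range] and extended by
    contractivity. For [d = adj xs], symmetry gives
    [|SH t d - d|^2 = phi (2 * t) - 2 * phi t + phi 0], where
    [phi s := xs (S s (i d))] is continuous at [0] because [S] is. *)
Lemma restriction_C0 : C0_semigroup SH.
Proof.
have [_ S0 SD _] := S_C0.
split.
- move=> t t0; apply: bounded_linear_continuous.
  apply/ex_bound; exists 1; apply/nbhs_norm0P; exists 1 => //= x /= x1.
  exact: le_trans (SH_contr t0 x) (ltW x1).
- by move=> h; apply: i_inj; rewrite -SH_restr// S0.
- move=> s t s0 t0 h; apply: i_inj.
  by rewrite -!SH_restr// ?addr_ge0// SD.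
- move=> h; apply/cvgrPdist_lt => e e0.
  have e3 : 0 < e / 3 by rewrite divr_gt0.
  have [xs cx hx] := adj_dense h e3.
  have [M M0 HM] := continuous_linear_bound cx.
  have d0 : 0 < (e / 3) ^+ 2 / (3 * M) by rewrite divr_gt0 ?exprn_gt0// mulr_gt0.
  have [c c0 Hc] := C0_near0 S_C0 (i (adj xs)) d0.
  exists (c / 2); first by rewrite /= divr_gt0.
  move=> t /= + t0; rewrite sub0r normrN gtr0_norm// => tc.
  have t_ge0 := ltW t0.
  set y := i (adj xs) in Hc.
  have small s : 0 <= s -> s < c -> `|xs (S s y) - xs y| < (e / 3) ^+ 2 / 3.
    move=> s0 sc; rewrite -linearB; apply: (le_lt_trans (HM _)).
    have := Hc s s0 sc; rewrite -(ltr_pM2l M0) => /lt_le_trans; apply.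
    by rewrite le_eqVlt; apply/orP; left; apply/eqP; field; rewrite gt_eqF.
  have near_adj : `|orbit t xs - adj xs| < e / 3.
    rewrite -(@ltr_pXn2r _ 2)// ?nnegrE ?(ltW e3)//.
    rewrite (normrD_sqr hilbertH) innerNr normrN -!(inner_norm hilbertH).
    rewrite -(orbit0 cx) !inner_orbit// addr0 add0r S0 -/y.
    have b1 : `|xs (S (t + t) y) - xs y| < (e / 3) ^+ 2 / 3.
      by apply: small; [rewrite addr_ge0|move: tc; lra].
    have b2 : `|xs (S t y) - xs y| < (e / 3) ^+ 2 / 3.
      by apply: small => //; move: tc t0; lra.
    have lin (u v w r : R) : `|u - w| < r / 3 -> `|v - w| < r / 3 ->
        u + 2 * - v + w < r.
      by rewrite !ltr_norml => /andP[_ ?] /andP[? _]; lra.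
    exact: lin b1 b2.
  have -> : h - SH t h = (h - adj xs) - (SH t (h - adj xs)) -
      (orbit t xs - adj xs).
    rewrite linearB restriction_adj//.
    by rewrite !opprB (addrC (orbit t xs)) (addrC (adj xs) (- _)) -!addrA
      addNKr (addrC _ (adj xs)) addKr.
  apply: (le_lt_trans (ler_normB _ _)).
  have := ler_normB (h - adj xs) (SH t (h - adj xs)).
  have := SH_contr t_ge0 (h - adj xs).
  move: hx near_adj; lra.
Qed.

End restriction.

End Q_symmetric_semigroup.

Theorem theorem4p5 (R : realType) (E H : completeNormedModType R)
    (dot : {dot H for idfun}) (i : {linear H -> E})
    (S : R -> {linear E -> E})
    (hilbertH : hilbert_norm dot)
    (i_cont : continuous i) (i_inj : injective i)
    (S_C0 : C0_semigroup S)
    (Q_lim : forall xs : {linear E -> R^o}, continuous xs ->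
       exists q : E, weak_cvg +oo (fun t : R => Qt dot i S t xs) q)
    (Q_sym : Q_symmetric dot i S) :
  exists SH : R -> {linear H -> H},
    [/\ restricts_to i S SH,
        C0_semigroup SH,
        selfadjoint_semigroup SH dot,
        contraction_semigroup SH &
        strongly_stable SH].
Proof.
have [SH [SH_restr SH_contr]] :=
  restriction_exists hilbertH i_cont i_inj S_C0 Q_sym Q_lim.
exists SH; split => //.
- exact: (restriction_C0 hilbertH i_cont i_inj S_C0 Q_sym SH_restr SH_contr).
- exact: (restriction_selfadjoint hilbertH i_cont i_inj S_C0 Q_sym SH_restr SH_contr).
- exact: (restriction_strongly_stable hilbertH i_cont i_inj S_C0 Q_sym Q_lim
    SH_restr SH_contr).
Qed.
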